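(* Let $M,a$ be real constants and $k\in\tfrac12\mathbb{Z}$. On the region $\mathcal{U}=\{(t,r,q,\phi): \Delta(r)>0,\ -1<q<1\}$, with $q=\cos\theta$, $\theta\in(0,\pi)$, let $g=\lambda_+^2 g_{Kerr}$ be the complex metric conformal to the Kerr metric, let $\nabla$ be its Levi-Civita connection, $s$ its scalar curvature, and let $a_\mu$ be the complex 1-form defined in the context. Define the operator on smooth complex functions $$\mathcal{O}_k\Phi=-(\nabla^\alpha+{\rm i}k a^\alpha)(\nabla_\alpha+{\rm i}k a_\alpha)\Phi+\frac{1+2k^2}{6}\,s\,\Phi,$$ (indices raised with $g$), and let $\mathcal{O}^T_k$ be the spin-$k$ Teukolsky operator $$\mathcal{O}_k^T = \Big[\tfrac{(r^2 + a^2)^2}{\Delta} - a^2 \sin^2\theta\Big]\partial_t^2 + \tfrac{4Mar}{\Delta}\partial_t \partial_\phi + \Big[\tfrac{a^2}{\Delta} - \tfrac{1}{\sin^2\theta}\Big]\partial_\phi^2 - \Delta^{-k}\partial_r ( \Delta^{k+1}\partial_r ) - \tfrac{1}{\sin\theta}\partial_\theta ( \sin\theta\, \partial_\theta ) - 2k \Big[ \tfrac{M(r^2 - a^2)}{\Delta}- r + {\rm i} a \cos\theta \Big]\partial_t - 2k \Big[\tfrac{a(r-M)}{\Delta} - \tfrac{{\rm i}\cos\theta}{\sin^2\theta} \Big]\partial_\phi + \left(k^2 \cot^2\theta - k\right).$$ Then, as operators on smooth complex functions on $\mathcal{U}$, $$\mathcal{O}^T_k = \frac{\lambda_+}{\lambda_-}\,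 \frac{\lambda_+}{\Delta^{k/2}}\, \mathcal{O}_k \circ \frac{\Delta^{k/2}}{\lambda_+},$$ i.e. $\mathcal{O}^T_k\Phi=\frac{\lambda_+}{\lambda_-}\frac{\lambda_+}{\Delta^{k/2}}\,\mathcal{O}_k\!\left(\frac{\Delta^{k/2}}{\lambda_+}\Phi\right)$ for all $\Phi$.
   Context: Coordinates $(t,r,q,\phi)$, $q=\cos\theta$. Set $C(r)=\Delta(r)=r^2-2Mr+a^2$, $D(q)=1-q^2=\sin^2\theta$, $\rho^2=r^2+a^2q^2$, $A=dt-a(1-q^2)\,d\phi$, $B=a\,dt-(r^2+a^2)\,d\phi$. The Kerr metric is $g_{Kerr}=-\frac{C}{\rho^2}A^2+\frac{\rho^2}{C}dr^2+\frac{\rho^2}{D}dq^2+\frac{D}{\rho^2}B^2$. Define $\lambda_\pm=\frac{1}{r\pm{\rm i}aq}$ (so $\rho^2=(\lambda_+\lambda_-)^{-1}$) and the complex-valued metric $g=\lambda_+^2 g_{Kerr}$; its Levi-Civita connection and scalar curvature are computed by the usual formulas (complex-valued). The 1-form $a$ is $$a={\rm i}\,\frac{C}{\rho^2}\Big(\frac{C_r}{2C}-2\lambda_+\Big)A-\frac{D}{\rho^2}\Big(\frac{D_q}{2D}-2{\rm i}a\lambda_+\Big)B,$$ where $C_r=\partial_rC$, $D_q=\partial_qD$ (equivalently, $a=J\,d\log(\sqrt{CD}\,\lambda_+^2)$ with $J$ the endomorphism obtained from the 2-form ${\rm i}A\wedge dr-B\wedge dq$ by raising an index with $g_{Kerr}$).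 In $(\nabla_\alpha+{\rm i}ka_\alpha)$ applied to a function $\Phi$ one gets the 1-form $\partial_\alpha\Phi+{\rm i}ka_\alpha\Phi$, and $(\nabla^\alpha+{\rm i}ka^\alpha)$ applied to a 1-form $v_\alpha$ gives $\nabla^\alpha v_\alpha+{\rm i}ka^\alpha v_\alpha$.
   Formalization: The ring r=0, q=0 is removed from the region U: when a≠0 it satisfies Δ(r)=a²>0 and -1<q<1, but there ρ²=0 and λ₊ and the metric g are undefined. *)

(* Defs.v *)
(* R : realType, complex numbers R[i]
   (mathcomp-real-closed `complex`).  Points of R^4 are row vectors 'rV[R]_4
   with coordinates (x^0,x^1,x^2,x^3) = (t,r,q,phi)  (or (t,r,theta,phi) for
   the Teukolsky operator). *)
From mathcomp Require Import all_boot all_order all_algebra.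
From mathcomp Require Import all_classical all_reals all_analysis.
From mathcomp Require Import complex.
Import Order.TTheory GRing.Theory Num.Theory ComplexField.
Import numFieldNormedType.Exports.

Set Implicit Arguments.
Unset Strict Implicit.
Unset Printing Implicit Defensive.

Local Open Scope ring_scope.
Local Open Scope complex_scope.

Section KerrTeukolsky.
Context {R : realType}.

Local Notation pt := ('rV[R]_4).
Local Notation C := (R[i]).

Definition i0 : 'I_4 := @Ordinal 4 0 isT.
Definition i1 : 'I_4 := @Ordinal 4 1 isT.
Definition i2 : 'I_4 := @Ordinal 4 2 isT.
Definition i3 : 'I_4 := @Ordinal 4 3 isT.

Definition kcoord (x : pt) (i : 'I_4) : R := x ord0 i.

Definition mkpt (x0 x1 x2 x3 : R) : pt :=
  \row_(i < 4) nth 0 [:: x0; x1; x2; x3] i.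

Definition ei (i : 'I_4) : pt := delta_mx ord0 i.

Definition pd (i : 'I_4) (f : pt -> C) (x : pt) : C :=
  Complex (derive1 (fun s : R => complex.Re (f (x + s *: ei i))) 0)
          (derive1 (fun s : R => complex.Im (f (x + s *: ei i))) 0).

Definition iterpd (l : seq 'I_4) (f : pt -> C) : pt -> C :=
  foldr (fun i g => pd i g) f l.

Definition smooth_on (U : set pt) (f : pt -> C) : Prop :=
  forall (l : seq 'I_4) (x : pt), U x ->
    (forall i : 'I_4,
        derivable (fun s : R => complex.Re (iterpd l f (x + s *: ei i))) 0 1 /\
        derivable (fun s : R => complex.Im (iterpd l f (x + s *: ei i))) 0 1) /\
    {for x, continuous (fun y => complex.Re (iterpd l f y))} /\
    {for x, continuous (fun y => complex.Im (iterpd l f y))}.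

Definition Delta (M a r : R) : R := r ^+ 2 - 2 * M * r + a ^+ 2.
Definition Dq (q : R) : R := 1 - q ^+ 2.
Definition rho2 (a r q : R) : R := r ^+ 2 + a ^+ 2 * q ^+ 2.

(* region U = {Delta(r) > 0, -1 < q < 1}, with the ring singularity
   rho^2 = 0 (where lambda_+ and the metric are undefined) removed *)
Definition regionU (M a : R) : set pt :=
  [set x | 0 < Delta M a (kcoord x i1) /\ -1 < kcoord x i2 < 1 /\
           rho2 a (kcoord x i1) (kcoord x i2) != 0].

Definition formA (a : R) (x : pt) (mu : 'I_4) : R :=
  if mu == i0 then 1 else if mu == i3 then - a * Dq (kcoord x i2) else 0.
Definition formB (a : R) (x : pt) (mu : 'I_4) : R :=
  if mu == i0 then a else if mu == i3 then - (kcoord x i1 ^+ 2 + a ^+ 2) else 0.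

Definition kd (i mu nu : 'I_4) : R := ((mu == i) && (nu == i))%:R.

Definition gKerr (M a : R) (x : pt) (mu nu : 'I_4) : R :=
  let r := kcoord x i1 in let q := kcoord x i2 in
  - (Delta M a r / rho2 a r q) * formA a x mu * formA a x nu
  + (rho2 a r q / Delta M a r) * kd i1 mu nu
  + (rho2 a r q / Dq q) * kd i2 mu nu
  + (Dq q / rho2 a r q) * formB a x mu * formB a x nu.

Definition lamp (a : R) (x : pt) : C :=
  (Complex (kcoord x i1) (a * kcoord x i2))^-1.
Definition lamm (a : R) (x : pt) : C :=
  (Complex (kcoord x i1) (- (a * kcoord x i2)))^-1.

Definition gmet (M a : R) (x : pt) : 'M[C]_4 :=
  \matrix_(mu, nu) (lamp a x ^+ 2 * (gKerr M a x mu nu)%:C).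
Definition ginv (M a : R) (x : pt) : 'M[C]_4 := invmx (gmet M a x).

Definition Chr (M a : R) (x : pt) (c al be : 'I_4) : C :=
  2^-1 * \sum_(d < 4) ginv M a x c d *
    (pd al (fun y => gmet M a y d be) x + pd be (fun y => gmet M a y d al) x
     - pd d (fun y => gmet M a y al be) x).

Definition Ric (M a : R) (x : pt) (be de : 'I_4) : C :=
  \sum_(c < 4) (pd c (fun y => Chr M a y c be de) x
                - pd de (fun y => Chr M a y c be c) x
                + \sum_(e < 4) (Chr M a x c c e * Chr M a x e be de
                                - Chr M a x c de e * Chr M a x e be c)).

Definition scal (M a : R) (x : pt) : C :=
  \sum_(be < 4) \sum_(de < 4) ginv M a x be de * Ric M a x be de.

(* the 1-form a_mu:
   a = i (C/rho^2)(C_r/(2C) - 2 lambda_+) A - (D/rho^2)(D_q/(2D) - 2 i a lambda_+) B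
   with C_r = 2r - 2M, D_q = -2q *)
Definition aform (M a : R) (x : pt) (mu : 'I_4) : C :=
  let r := kcoord x i1 in let q := kcoord x i2 in
  'i * (Delta M a r / rho2 a r q)%:C
     * (((2 * r - 2 * M) / (2 * Delta M a r))%:C - 2%:R * lamp a x)
     * (formA a x mu)%:C
  - (Dq q / rho2 a r q)%:C
     * (((- (2 * q)) / (2 * Dq q))%:C - 2%:R * 'i * a%:C * lamp a x)
     * (formB a x mu)%:C.

Definition vfield (M a k : R) (Phi : pt -> C) (x : pt) (al : 'I_4) : C :=
  pd al Phi x + 'i * k%:C * aform M a x al * Phi x.

Definition Ok (M a k : R) (Phi : pt -> C) (x : pt) : C :=
  - (\sum_(al < 4) \sum_(be < 4) ginv M a x al be *
       (pd be (fun y => vfield M a k Phi y al) x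
        - \sum_(c < 4) Chr M a x c be al * vfield M a k Phi x c
        + 'i * k%:C * aform M a x be * vfield M a k Phi x al))
  + ((1 + 2 * k ^+ 2) / 6)%:C * scal M a x * Phi x.

(* spin-k Teukolsky operator in Boyer-Lindquist coordinates (t,r,theta,phi),
   acting on Psi : pt -> C where pt coordinates are (t,r,theta,phi) *)
Definition Teuk (M a k : R) (Psi : pt -> C) (y : pt) : C :=
  let r := kcoord y i1 in let th := kcoord y i2 in
  let D := Delta M a r in
  (((r ^+ 2 + a ^+ 2) ^+ 2 / D - a ^+ 2 * sin th ^+ 2)%:C) * pd i0 (pd i0 Psi) y
  + ((4 * M * a * r / D)%:C) * pd i0 (pd i3 Psi) y
  + ((a ^+ 2 / D - 1 / sin th ^+ 2)%:C) * pd i3 (pd i3 Psi) y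
  - ((D `^ (- k))%:C) *
      pd i1 (fun z => ((Delta M a (kcoord z i1)) `^ (k + 1))%:C * pd i1 Psi z) y
  - ((1 / sin th)%:C) * pd i2 (fun z => (sin (kcoord z i2))%:C * pd i2 Psi z) y
  - (2 * k)%:C * ((M * (r ^+ 2 - a ^+ 2) / D - r)%:C + 'i * (a * cos th)%:C)
      * pd i0 Psi y
  - (2 * k)%:C * ((a * (r - M) / D)%:C - 'i * (cos th / sin th ^+ 2)%:C)
      * pd i3 Psi y
  + ((k ^+ 2 * (cos th / sin th) ^+ 2 - k)%:C) * Psi y.

End KerrTeukolsky.

(* Main.v *)
Require Import Defs.
From mathcomp Require Import all_boot all_order all_algebra.
From mathcomp Require Import all_classical all_reals all_analysis.
From mathcomp Require Import complex ring.
Import Order.TTheory GRing.Theory Num.Theory ComplexField.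
Import numFieldNormedType.Exports.
Local Open Scope ring_scope.
Local Open Scope complex_scope.

Set Implicit Arguments.
Unset Strict Implicit.
Unset Printing Implicit Defensive.

(* Put z = r + i a q and w = r - i a q, so that lambda_+ = 1/z, lambda_- = 1/w
   and rho^2 = z w; write C = Delta, D = 1 - q^2, W = Delta^(k/2) and
   X = (r^2 + a^2) d_t + a d_phi, Y = a D d_t + d_phi.  The inverse of g is
     (z/w) (C d_r d_r + D d_q d_q + Y Y / D - X X / C)
   and its volume density is w/z^3 up to a constant.  Hence the Laplacian
   twisted by the 1-form theta = i k a is z/w times
     C d_r^2 + (C' - 2 C/z) d_r + D d_q^2 + (D' - 2 i a D/z) d_q
     + (Y + theta(Y))^2 / D - (X + theta(X))^2 / C,
   where theta(X) = - k (C'/2 - 2 C/z) and theta(Y) = i k (D'/2 - 2 i a D/z).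
   On W z Phi the weight cancels the first order terms in 1/z of the radial and
   polar parts, and those of the X and Y parts combine to a multiple of d_t
   because X - a Y = z w d_t.  The zeroth order terms in 1/z and 1/z^2 add up to
   (1 + 2 k^2) S Phi with
     S = (C' + i a D')/z - 2 (C - a^2 D)/z^2 = (w/z) s/6,
   so the scalar curvature term removes them and the Teukolsky operator remains.
   The components of the metric, the connection and the curvature are
   polynomials in finitely many functions whose derivatives are again such
   polynomials; this makes the curvature a matter of symbolic computation.  The
   only other input is the symmetry of the mixed derivative of Phi in t, phi. *)

(** * Complex-valued functions of a real variable *)

Section ComplexDerivative.
Context {R : realType}.
Local Notation C := (R[i]).
Implicit Types (f g : R -> C) (h : R -> R) (s : R) (l : C).

Definition is_cderive s f l :=
  is_derive s 1 (fun t => complex.Re (f t)) (complex.Re l) /\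
  is_derive s 1 (fun t => complex.Im (f t)) (complex.Im l).

Lemma is_cderive_eq s f l l' : is_cderive s f l -> l = l' -> is_cderive s f l'.
Proof. by move=> + <-. Qed.

Lemma near_eq_is_cderive s f g l :
  (\forall t \near s, f t = g t) -> is_cderive s f l -> is_cderive s g l.
Proof.
by move=> fg [dr di]; split; [apply: near_eq_is_derive dr|
  apply: near_eq_is_derive di]; near do congr (_ _).
Unshelve. all: by end_near. Qed.

Lemma is_cderive_real s h (b : R) :
  is_derive s 1 h b -> is_cderive s (fun t => (h t)%:C) b%:C.
Proof. by move=> dh; split => //=; exact: is_derive_cst. Qed.

Lemma is_cderive_cst s l : is_cderive s (fun=> l) 0.
Proof. by split; exact: is_derive_cst. Qed.

Lemma is_cderive_conj s f l :
  is_cderive s f l -> is_cderive s (fun t => (f t)^*) l^*.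
Proof.
case: l => a b [/= dr /is_deriveN di]; split.
  by move: dr; congr (is_derive _ _ _ _); apply/funext => t; case: (f t).
move: di; congr (is_derive _ _ _ _); apply/funext => t.
by rewrite -[LHS]/(- _); case: (f t).
Qed.

Lemma is_cderiveN s f l :
  is_cderive s f l -> is_cderive s (fun t => - f t) (- l).
Proof.
case: l => a b [/= /is_deriveN dr /is_deriveN di]; split.
- move: dr; congr (is_derive _ _ _ _); apply/funext => t.
  by rewrite -[LHS]/(- _); case: (f t).
- move: di; congr (is_derive _ _ _ _); apply/funext => t.
  by rewrite -[LHS]/(- _); case: (f t).
Qed.

Lemma is_cderiveD s f g l l' : is_cderive s f l -> is_cderive s g l' ->
  is_cderive s (fun t => f t + g t) (l + l').
Proof.
case: l l' => a b [a' b'] [/= dr di] [/= dr' di']; split => /=.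
- have := is_deriveD dr dr'; congr (is_derive _ _ _ _).
  by apply/funext => t; rewrite -[LHS]/(_ + _); case: (f t) (g t) => ? ? [].
- have := is_deriveD di di'; congr (is_derive _ _ _ _).
  by apply/funext => t; rewrite -[LHS]/(_ + _); case: (f t) (g t) => ? ? [].
Qed.

Lemma is_cderiveM s f g l l' : is_cderive s f l -> is_cderive s g l' ->
  is_cderive s (fun t => f t * g t) (l * g s + f s * l').
Proof.
case: l l' => a b [a' b'] [/= dr di] [/= dr' di']; split.
- have := is_deriveB (is_deriveM dr dr') (is_deriveM di di').
  congr (is_derive _ _ _ _).
    apply/funext => t; rewrite -[LHS]/(_ * _ - _ * _).
    by case: (f t) (g t) => ? ? [].
  by case: (f s) (g s) => ? ? [? ?]; rewrite /GRing.scale /=; ring.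
- have := is_deriveD (is_deriveM dr di') (is_deriveM di dr').
  congr (is_derive _ _ _ _).
    apply/funext => t; rewrite -[LHS]/(_ * _ + _ * _).
    by case: (f t) (g t) => ? ? [].
  by case: (f s) (g s) => ? ? [? ?]; rewrite /GRing.scale /=; ring.
Qed.

Lemma is_cderiveV s f l : f s != 0 -> is_cderive s f l ->
  is_cderive s (fun t => (f t)^-1) (- (l / f s ^+ 2)).
Proof.
move=> f0 df; pose norm2 t := complex.Re (f t) ^+ 2 + complex.Im (f t) ^+ 2.
have norm2E t : (norm2 t)%:C = f t * (f t)^*.
  by rewrite /norm2; case: (f t) => a b /=; simpc; congr Complex; ring.
have fc0 : (f s)^* != 0 by rewrite conjc_eq0.
have n0 : norm2 s != 0.
  by rewrite -(fmorph_eq0 (real_complex R)) /= norm2E mulf_neq0.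
have dnorm2 : is_derive s 1 norm2 (complex.Re (l * (f s)^* + f s * l^*)).
  have [+ _] := is_cderiveM df (is_cderive_conj df).
  by under eq_fun do rewrite -norm2E.
have -> : (fun t => (f t)^-1) = (fun t => (f t)^* * ((norm2 t)^-1)%:C).
  by apply/funext => t; rewrite /norm2; case: (f t) => a b; simpc.
apply: is_cderive_eq (is_cderiveM (is_cderive_conj df)
  (is_cderive_real (is_deriveV n0 dnorm2))) _.
have -> : (- norm2 s ^- 2 *: complex.Re (l * (f s)^* + f s * l^*))%:C =
    - (l * (f s)^* + f s * l^*) / (norm2 s)%:C ^+ 2.
  rewrite rmorphM rmorphN fmorphV rmorphXn mulNr mulrC -mulNr; congr (- _ / _).
  by case: (f s) l {df dnorm2} => a b [c d] /=; simpc; congr Complex; ring.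
by rewrite fmorphV /= norm2E; field; rewrite f0 fc0.
Qed.

Lemma is_cderive_comp s f h l (b : R) :
  is_cderive (h s) f l -> is_derive s 1 h b ->
  is_cderive s (fun t => f (h t)) (b%:C * l).
Proof.
case: l => a c [/= dr di] dh; split; rewrite /= mul0r ?subr0 ?addr0 mulrC.
  exact: is_derive1_comp dr dh.
exact: is_derive1_comp di dh.
Qed.

End ComplexDerivative.

(** * Partial derivatives and their symmetry *)

Section SecondDifference.
Context {R : realType}.
Implicit Types (f fs fu fsu fus : R -> R -> R) (s u h : R).

Definition second_difference f s u h : R :=
  f (s + h) (u + h) - f (s + h) u - (f s (u + h) - f s u).

Lemma second_differenceC f s u h :
  second_difference (fun u s => f s u) u s h = second_difference f s u h.
Proof. by rewrite /second_difference; ring. Qed.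

Lemma second_difference_mvt f fs fsu s0 u0 h : 0 < h ->
  {in `[s0, s0 + h] & `[u0, u0 + h], forall s u,
    is_derive s 1 (f^~ u) (fs s u) /\ is_derive u 1 (fs s) (fsu s u)} ->
  exists s u, [/\ s \in `]s0, (s0 + h)[, u \in `]u0, (u0 + h)[ &
    second_difference f s0 u0 h = fsu s u * h ^+ 2].
Proof.
move=> h0 df; have [s0h u0h] : s0 < s0 + h /\ u0 < u0 + h by rewrite !ltrDl.
have continuousW (g g' : R -> R) (a : R) :
    {in `[a, a + h], forall t : R, is_derive t 1 g (g' t)} ->
    {within `[a, a + h], continuous g}%classic.
  by move=> dg; apply: derivable_within_continuous => t /dg[].
have dfs u : u \in `[u0, u0 + h] ->
    {in `[s0, s0 + h], forall s : R, is_derive s 1 (f^~ u) (fs s u)}.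
  by move=> uI s sI; have [] := df s u sI uI.
have d_diff : {in `[s0, s0 + h], forall s : R,
    is_derive s 1 (f^~ (u0 + h) - f^~ u0) (fs s (u0 + h) - fs s u0)}.
  by move=> s sI; apply: is_deriveB; apply: dfs; rewrite // bound_itvE ltW.
have [s sI diffE] := MVT s0h (fun t tI => d_diff t (subset_itv_oo_cc tI))
  (continuousW _ _ _ d_diff).
have dfsu : {in `[u0, u0 + h], forall u : R, is_derive u 1 (fs s) (fsu s u)}.
  by move=> u uI; have [] := df s u (subset_itv_oo_cc sI) uI.
have [u uI fsE] := MVT u0h (fun t tI => dfsu t (subset_itv_oo_cc tI))
  (continuousW _ _ _ dfsu).
by exists s, u; split=> //; rewrite [LHS]diffE fsE; ring.
Qed.

Lemma ball_square s0 u0 s u (d : R) : 0 < d ->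
  s \in `[s0, s0 + d / 2] -> u \in `[u0, u0 + d / 2] ->
  ball ((s0, u0) : R * R) d (s, u).
Proof.
move=> d0; suff close (t t0 : R) : t \in `[t0, t0 + d / 2] -> `|t0 - t| < d.
  by move=> /close s_near /close u_near.
rewrite in_itv /= => /andP[t0t tt0]; rewrite distrC ger0_norm ?subr_ge0 //.
by rewrite ltrBlDl (le_lt_trans tt0) // ltrD2l ltr_pdivrMr // ltr_pMr // ltr1n.
Qed.

Lemma mixed_derive_eq f fs fu fsu fus s0 u0 :
  (\forall p \near ((s0, u0) : R * R),
    (is_derive (p.1 : R) 1 (f^~ (p.2 : R)) (fs p.1 p.2) /\
     is_derive p.2 1 (fs p.1) (fsu p.1 p.2)) /\
    (is_derive p.2 1 (f p.1) (fu p.1 p.2) /\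
     is_derive p.1 1 (fu^~ p.2) (fus p.1 p.2))) ->
  {for (s0, u0), continuous (fun p => fsu p.1 p.2)} ->
  {for (s0, u0), continuous (fun p => fus p.1 p.2)} ->
  fsu s0 u0 = fus s0 u0.
Proof.
move=> df continuous_fsu continuous_fus.
apply/eqP; rewrite -subr_eq0 -normr_le0; apply/ler_addgt0Pr => e e0.
have e20 : 0 < e / 2 by rewrite divr_gt0.
have near_fsu : \forall p \near ((s0, u0) : R * R),
    `|fsu s0 u0 - fsu p.1 p.2| < e / 2.
  by move/cvgr_dist_lt: continuous_fsu; apply.
have near_fus : \forall p \near ((s0, u0) : R * R),
    `|fus s0 u0 - fus p.1 p.2| < e / 2.
  by move/cvgr_dist_lt: continuous_fus; apply.
have F : Filter (nbhs ((s0, u0) : R * R)) := nbhs_filter _.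
have /nbhs_ballP[d /= d0 ball_d] :=
  @filterI _ _ F _ _ df (@filterI _ _ F _ _ near_fsu near_fus).
pose h := d / 2; have h0 : 0 < h by rewrite divr_gt0.
have [s [u [sI uI fsuE]]] : exists s u, [/\ s \in `]s0, (s0 + h)[,
    u \in `]u0, (u0 + h)[ & second_difference f s0 u0 h = fsu s u * h ^+ 2].
  apply: (second_difference_mvt (fs := fs)) => // s u sI uI.
  by have [[]] := ball_d _ (ball_square d0 sI uI).
have [u' [s' [uI' sI' fusE]]] : exists u s, [/\ u \in `]u0, (u0 + h)[,
    s \in `]s0, (s0 + h)[ & second_difference f s0 u0 h = fus s u * h ^+ 2].
  rewrite -second_differenceC; apply: (second_difference_mvt
    (fs := fun u s => fu s u) (fsu := fun u s => fus s u)) => // t' t tI' tI.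
  by have [[_ []]] := ball_d _ (ball_square d0 tI tI').
have fsu_fus : fsu s u = fus s' u'.
  by apply: (mulIf (lt0r_neq0 (exprn_gt0 2 h0))); rewrite -fsuE -fusE.
have [_ [fsu_close _]] := ball_d _ (ball_square d0
  (subset_itv_oo_cc sI) (subset_itv_oo_cc uI)).
have [_ [_ fus_close]] := ball_d _ (ball_square d0
  (subset_itv_oo_cc sI') (subset_itv_oo_cc uI')).
rewrite add0r (splitr e) -(subrKA (fsu s u)).
apply: le_trans (ler_normD _ _) _; rewrite lerD // ltW //.
by rewrite distrC fsu_fus.
Qed.

End SecondDifference.

Section PartialDerivative.
Context {R : realType}.
Local Notation pt := ('rV[R]_4).
Local Notation C := (R[i]).
Implicit Types (i j : 'I_4) (f g : pt -> C) (x y : pt) (s u : R) (l : C).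
Implicit Types (D : set pt) (js : seq 'I_4).

Definition is_pd i f x l := is_cderive 0 (fun s => f (x + s *: ei i)) l.

Lemma is_pd_val i f x l : is_pd i f x l -> pd i f x = l.
Proof.
case: l => a b [/= dr di]; rewrite /pd !derive1E.
by congr Complex; apply: derive_val.
Qed.

Lemma is_pdN i f x l : is_pd i f x l -> is_pd i (fun y => - f y) x (- l).
Proof. exact: is_cderiveN. Qed.

Lemma is_pdM i f g x l l' : is_pd i f x l -> is_pd i g x l' ->
  is_pd i (fun y => f y * g y) x (l * g x + f x * l').
Proof. by move=> df /(is_cderiveM df); rewrite scale0r addr0. Qed.

Lemma is_pdV i f x l : f x != 0 -> is_pd i f x l ->
  is_pd i (fun y => (f y)^-1) x (- (l / f x ^+ 2)).
Proof.
have := @is_cderiveV R 0 (fun s => f (x + s *: ei i)) l.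
by rewrite scale0r addr0; apply.
Qed.

Lemma is_pd_line i f x s l : is_pd i f (x + s *: ei i) l ->
  is_cderive s (fun t => f (x + t *: ei i)) l.
Proof.
move=> df; rewrite -[l]mul1r.
have -> : (fun t => f (x + t *: ei i)) =
    (fun t => f (x + s *: ei i + shift (- s) t *: ei i)).
  by apply/funext => t; rewrite /shift /= -addrA -scalerDl [s + _]addrC subrK.
apply: (is_cderive_comp (f := fun t => f (x + s *: ei i + t *: ei i)) _
  (is_derive_shift s 1 (- s))).
by rewrite /shift /= subrr.
Qed.

Lemma is_pd_iterpd D f i js x : smooth_on D f -> D x ->
  is_pd i (iterpd js f) x (iterpd (i :: js) f x).
Proof.
move=> sf Dx; have [/(_ i)[dr di] _] := sf js x Dx.
by split; rewrite /= derive1E; [exact: (derivableP dr)|exact: (derivableP di)].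
Qed.

Lemma near_line D x (y : pt) : open D -> D x ->
  \forall s \near (0 : R), D (x + s *: y).
Proof.
move=> oD Dx.
have continuous_line : {for 0, continuous (fun s : R => x + s *: y)}.
  by apply: cvgD; [exact: cvg_cst|apply: cvgZr_tmp; exact: cvg_id].
by apply: continuous_line; apply: open_nbhs_nbhs; rewrite scale0r addr0.
Qed.

Definition plane x i j s u : pt := x + s *: ei i + u *: ei j.

Lemma plane00 x i j : plane x i j 0 0 = x.
Proof. by rewrite /plane !scale0r !addr0. Qed.

Lemma continuous_plane00 x i j :
  {for (0, 0), continuous (fun p : R * R => plane x i j p.1 p.2)}.
Proof.
apply: cvgD; last by apply: cvgZr_tmp; exact: cvg_snd.
by apply: cvgD; [exact: cvg_cst|apply: cvgZr_tmp; exact: cvg_fst].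
Qed.

Lemma is_cderive_plane_l f x i j s u l : is_pd i f (plane x i j s u) l ->
  is_cderive s (fun t => f (plane x i j t u)) l.
Proof.
have planeE t : plane x i j t u = x + u *: ei j + t *: ei i.
  by rewrite /plane addrAC.
rewrite planeE => /is_pd_line.
by under [X in _ -> is_cderive _ X _]eq_fun do rewrite planeE.
Qed.

Section MixedPartials.
Variables (D : set pt) (f : pt -> C) (x : pt) (i j : 'I_4) (part : C -> R).
Hypotheses (open_D : open D) (smooth_f : smooth_on D f) (Dx : D x).
Hypothesis is_derive_part : forall s (g : R -> C) l,
  is_cderive s g l -> is_derive s 1 (fun t => part (g t)) (part l).
Hypothesis continuous_part : forall js,
  {for x, continuous (fun y => part (iterpd js f y))}.

Lemma pdC_part : part (pd j (pd i f) x) = part (pd i (pd j f) x).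
Proof.
pose d js s u := part (iterpd js f (plane x i j s u)).
have continuous_d js : {for (0, 0), continuous (fun p : R * R => d js p.1 p.2)}.
  apply: (continuous_comp (f := fun p : R * R => plane x i j p.1 p.2)
    (g := fun y => part (iterpd js f y))); first exact: continuous_plane00.
  by rewrite /= plane00; exact: continuous_part.
have near_D : \forall p \near ((0, 0) : R * R), D (plane x i j p.1 p.2).
  by apply: continuous_plane00; apply: open_nbhs_nbhs; rewrite /= plane00.
rewrite -(plane00 x i j); apply: (mixed_derive_eq (f := d [::])
  (fs := d [:: i]) (fu := d [:: j]) (fsu := d [:: j; i])
  (fus := d [:: i; j])) => //.
near=> p; have Dp : D (plane x i j p.1 p.2) by near: p.
have d_l js := is_derive_part
  (is_cderive_plane_l (is_pd_iterpd i js smooth_f Dp)).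
have d_r js := is_derive_part
  (is_pd_line (is_pd_iterpd j js smooth_f Dp)).
by split; split; [exact: d_l|exact: d_r|exact: d_r|exact: d_l].
Unshelve. all: by end_near. Qed.

End MixedPartials.

Lemma pdC D f x i j : open D -> smooth_on D f -> D x ->
  pd i (pd j f) x = pd j (pd i f) x.
Proof.
move=> open_D smooth_f Dx; apply/esym/eqP; rewrite eq_complex.
apply/andP; split; apply/eqP.
- apply: (pdC_part (part := @complex.Re R) i j open_D smooth_f Dx).
    by move=> s g l [].
  by move=> js; have [_ []] := smooth_f js x Dx.
- apply: (pdC_part (part := @complex.Im R) i j open_D smooth_f Dx).
    by move=> s g l [].
  by move=> js; have [_ []] := smooth_f js x Dx.
Qed.

End PartialDerivative.

(** * Polynomial expressions in differentiable atoms *)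

Lemma ord4_ind (P : 'I_4 -> Prop) :
  P i0 -> P i1 -> P i2 -> P i3 -> forall i, P i.
Proof.
move=> p0 p1 p2 p3 [[|[|[|[|//]]]] h].
- by rewrite (_ : Ordinal h = i0)//; apply: val_inj.
- by rewrite (_ : Ordinal h = i1)//; apply: val_inj.
- by rewrite (_ : Ordinal h = i2)//; apply: val_inj.
- by rewrite (_ : Ordinal h = i3)//; apply: val_inj.
Qed.

Lemma sum_ord4 (V : nmodType) (G : 'I_4 -> V) :
  \sum_(i < 4) G i = G i0 + G i1 + G i2 + G i3.
Proof.
rewrite !big_ord_recl big_ord0 addr0 !addrA.
by congr (G _ + G _ + G _ + G _); apply: val_inj.
Qed.

Inductive expr (A : Type) :=
  | Zero | One | Atom of A | Opp of expr A
  | Add of expr A & expr A | Mul of expr A & expr A.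
Arguments Zero {A}.
Arguments One {A}.

Declare Scope expr_scope.
Delimit Scope expr_scope with X.
Bind Scope expr_scope with expr.

(* The operations drop zeros and ones on the fly: most components of the
   metric vanish, and this keeps the curvature expression small. *)
Definition add_expr A (e f : expr A) : expr A :=
  match e, f with Zero, _ => f | _, Zero => e | _, _ => Add e f end.
Definition mul_expr A (e f : expr A) : expr A :=
  match e, f with
  | Zero, _ | _, Zero => Zero
  | One, _ => f
  | _, One => e
  | _, _ => Mul e f
  end.
Definition opp_expr A (e : expr A) : expr A :=
  if e is Zero then Zero else Opp e.

Arguments add_expr A !e !f.
Arguments mul_expr A !e !f.

Notation "x + y" := (add_expr x y) : expr_scope.
Notation "x * y" := (mul_expr x y) : expr_scope.
Notation "- x" := (opp_expr x) : expr_scope.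
Notation "x - y" := (add_expr x (opp_expr y)) : expr_scope.
Notation "0" := Zero : expr_scope.
Notation "1" := One : expr_scope.
Notation "2" := (Add One One) : expr_scope.

Definition sum_expr A (f : 'I_4 -> expr A) : expr A :=
  (f i0 + f i1 + f i2 + f i3)%X.

Definition vec4 A (t r q p : expr A) (i : 'I_4) : expr A :=
  nth Zero [:: t; r; q; p] i.

Fixpoint derive_expr A (d : A -> expr A) (e : expr A) : expr A :=
  match e with
  | Zero | One => 0
  | Atom x => d x
  | Opp f => - derive_expr d f
  | Add f g => derive_expr d f + derive_expr d g
  | Mul f g => derive_expr d f * g + f * derive_expr d g
  end%X.

Section Evaluation.
Variables (A : Type) (F : nzRingType) (v : A -> F).
Implicit Types (e f : expr A) (d : A -> expr A).

Fixpoint eval_expr e : F :=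
  match e with
  | Zero => 0
  | One => 1
  | Atom x => v x
  | Opp f => - eval_expr f
  | Add f g => eval_expr f + eval_expr g
  | Mul f g => eval_expr f * eval_expr g
  end.

Lemma eval_add e f : eval_expr (e + f)%X = eval_expr e + eval_expr f.
Proof. by case: e => //=; case: f => //= *; rewrite ?addr0 ?add0r. Qed.

Lemma eval_mul e f : eval_expr (e * f)%X = eval_expr e * eval_expr f.
Proof.
by case: e => //=; case: f => //= *; rewrite ?mulr0 ?mul0r ?mulr1 ?mul1r.
Qed.

Lemma eval_opp e : eval_expr (- e)%X = - eval_expr e.
Proof. by case: e => //=; rewrite oppr0. Qed.

Definition eval_opE := (eval_add, eval_mul, eval_opp).

Lemma eval_sum (f : 'I_4 -> expr A) :
  eval_expr (sum_expr f) = \sum_(i < 4) eval_expr (f i).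
Proof. by rewrite sum_ord4 !eval_add. Qed.

Lemma eval_derive_add d e f : eval_expr (derive_expr d (e + f)%X) =
  eval_expr (derive_expr d e) + eval_expr (derive_expr d f).
Proof.
by case: e f => [||?|?|? ?|? ?] [||?|?|? ?|? ?] //=;
  rewrite ?eval_opE /= ?(add0r, addr0).
Qed.

Lemma eval_derive_mul d e f : eval_expr (derive_expr d (e * f)%X) =
  eval_expr (derive_expr d e) * eval_expr f
  + eval_expr e * eval_expr (derive_expr d f).
Proof.
by case: e f => [||?|?|? ?|? ?] [||?|?|? ?|? ?] //=;
  rewrite ?eval_opE /= ?(mul0r, mulr0, mul1r, mulr1, add0r, addr0).
Qed.

Lemma eval_derive_sum d (f : 'I_4 -> expr A) :
  eval_expr (derive_expr d (sum_expr f)) =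
  \sum_(i < 4) eval_expr (derive_expr d (f i)).
Proof. by rewrite sum_ord4 !eval_derive_add. Qed.

End Evaluation.

Section Soundness.
Context {R : realType} (A : Type).

Lemma is_cderive_eval (v : R -> A -> R[i]) (d : A -> expr A) (s : R) :
  (forall x, is_cderive s (fun t => v t x) (eval_expr (v s) (d x))) ->
  forall e, is_cderive s (fun t => eval_expr (v t) e)
              (eval_expr (v s) (derive_expr d e)).
Proof.
move=> dv; elim=> [||x|e IH|e IHe f IHf|e IHe f IHf] /=.
- exact: is_cderive_cst.
- exact: is_cderive_cst.
- exact: dv.
- by rewrite eval_opp; exact: is_cderiveN.
- by rewrite eval_add; exact: is_cderiveD.
- by rewrite eval_add !eval_mul; exact: is_cderiveM.
Qed.

Lemma pd_eval (D : set 'rV[R]_4) (v : 'rV[R]_4 -> A -> R[i])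
    (d : 'I_4 -> A -> expr A) : open D ->
  (forall x i b, D x -> is_pd i (v^~ b) x (eval_expr (v x) (d i b))) ->
  forall (f : 'rV[R]_4 -> R[i]) e i x, D x ->
    (forall y, D y -> f y = eval_expr (v y) e) ->
  pd i f x = eval_expr (v x) (derive_expr (d i) e).
Proof.
move=> open_D dv f e i x Dx fE; apply: is_pd_val.
apply: near_eq_is_cderive (_ : is_cderive 0 (fun s => eval_expr _ e) _).
  near=> s; symmetry; apply: fE; near: s; exact: near_line.
have -> : v x = v (x + 0 *: ei i) by rewrite scale0r addr0.
apply: is_cderive_eval (fun s => v (x + s *: ei i)) _ _ _ _ => b.
by rewrite scale0r addr0; exact: dv.
Unshelve. all: by end_near. Qed.

End Soundness.

(** * Levi-Civita connection and twisted Laplacian of a symbolic metric *)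

Section LeviCivita.
Variables (A : Type) (d : 'I_4 -> A -> expr A) (half : expr A).
Variables (g gi : 'I_4 -> 'I_4 -> expr A).
Local Notation "'d_ i" := (derive_expr (d i)) (at level 10, i at level 2).

Definition christoffel (c m n : 'I_4) : expr A :=
  (half * sum_expr (fun p =>
     gi c p * ('d_m (g p n) + 'd_n (g p m) - 'd_p (g m n))))%X.

Definition ricci (m n : 'I_4) : expr A :=
  sum_expr (fun c => 'd_c (christoffel c m n) - 'd_n (christoffel c m c)
    + sum_expr (fun p => christoffel c c p * christoffel p m n
                         - christoffel c n p * christoffel p m c))%X.

Definition scalar_curvature : expr A :=
  sum_expr (fun m => sum_expr (fun n => gi m n * ricci m n))%X.

Definition derive_along (X : 'I_4 -> expr A) (e : expr A) : expr A :=
  sum_expr (fun m => X m * 'd_m e)%X.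

Variable theta : 'I_4 -> expr A.

Definition twisted_d (e : expr A) (m : 'I_4) : expr A :=
  ('d_m e + theta m * e)%X.

Definition twisted_along (X : 'I_4 -> expr A) (e : expr A) : expr A :=
  sum_expr (fun m => X m * twisted_d e m)%X.

Definition twisted_laplacian (e : expr A) : expr A :=
  sum_expr (fun m => sum_expr (fun n => gi m n *
    ('d_n (twisted_d e m)
     - sum_expr (fun c => christoffel c n m * twisted_d e c)
     + theta n * twisted_d e m)))%X.

Variables (F : comNzRingType) (v : A -> F).
Local Notation ev := (eval_expr v).

Lemma eval_derive_along (X : 'I_4 -> expr A) (e : expr A) :
  ev (derive_along X e) = \sum_(m < 4) ev (X m) * ev ('d_m e).
Proof. by rewrite eval_sum; apply: eq_bigr => m _; rewrite eval_mul. Qed.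

Lemma eval_twisted_along (X : 'I_4 -> expr A) (e : expr A) :
  ev (twisted_along X e) = \sum_(m < 4) ev (X m) * ev (twisted_d e m).
Proof. by rewrite eval_sum; apply: eq_bigr => m _; rewrite eval_mul. Qed.

Lemma eval_twisted_along_sqr (X : 'I_4 -> expr A) (e : expr A) :
  (forall m, ev (derive_along X (X m)) = 0) ->
  ev (twisted_along X (twisted_along X e)) = \sum_(m < 4) \sum_(n < 4)
    ev (X m) * ev (X n) * ev (twisted_d (twisted_d e m) n).
Proof.
move=> XX0; rewrite exchange_big eval_sum.
transitivity (\sum_(n < 4) (\sum_(m < 4)
      ev (X m) * ev (X n) * ev (twisted_d (twisted_d e m) n)
    + \sum_(m < 4) ev (X n) * ev ('d_n (X m)) * ev (twisted_d e m))).
  apply: eq_bigr => n _; rewrite eval_mul eval_add eval_mul eval_derive_sum.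
  rewrite eval_sum big_distrr -!big_split big_distrr /=.
  apply: eq_bigr => m _; rewrite /= eval_derive_mul eval_mul.
  by rewrite [ev (twisted_d _ n)]eval_add eval_mul; ring.
rewrite big_split /= [X in _ + X]exchange_big [X in _ + X]big1 ?addr0 // => m _.
by rewrite -big_distrl /= -eval_derive_along XX0 mul0r.
Qed.

Lemma eval_twisted_laplacian (e : expr A) : ev (twisted_laplacian e) =
  \sum_(m < 4) \sum_(n < 4) ev (gi m n) * ev (twisted_d (twisted_d e m) n)
  - \sum_(c < 4) (\sum_(m < 4) \sum_(n < 4)
      ev (gi m n) * ev (christoffel c n m)) * ev (twisted_d e c).
Proof.
under [X in _ - X]eq_bigr do rewrite big_distrl.
rewrite [X in _ - X]exchange_big -sumrB eval_sum; apply: eq_bigr => m _.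
under [X in _ - X]eq_bigr do rewrite big_distrl.
rewrite [X in _ - X]exchange_big -sumrB eval_sum; apply: eq_bigr => n _.
rewrite eval_mul [ev (twisted_d _ n)]eval_add eval_add eval_add eval_opp.
rewrite eval_sum addrAC mulrBr big_distrr; congr (_ - _).
by apply: eq_bigr => c _; rewrite /= eval_mul mulrA.
Qed.

End LeviCivita.

(** * The Kerr metric and the Teukolsky operator as expressions *)

(* [at_dDelta] and [at_dD] are the derivatives of C = Delta(r), D = 1 - q^2;
   [at_zinv], [at_winv], [at_Deltainv], [at_Dinv] the inverses of
   z = r + i a q, w = r - i a q, C and D, taken as atoms so that expressions are
   polynomial and always defined; [at_weight] is Delta^(k/2); [at_ia] is i a;
   [at_Phi l] is the iterated partial derivative along [l] of the unknown. *)
Inductive kerr_atom :=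
  | at_r | at_q | at_Delta | at_dDelta | at_D | at_dD
  | at_zinv | at_winv | at_Deltainv | at_Dinv | at_weight
  | at_a | at_ia | at_i | at_k | at_half | at_Phi of seq 'I_4.

Local Notation kexpr := (expr kerr_atom).
Coercion kerr_expr (b : kerr_atom) : kexpr := Atom b.

Definition radial (e : kexpr) : 'I_4 -> kexpr := vec4 0 e 0 0.
Definition polar (e : kexpr) : 'I_4 -> kexpr := vec4 0 0 e 0.

Definition kerr_d (i : 'I_4) (b : kerr_atom) : kexpr :=
  match b with
  | at_r => radial 1 i
  | at_q => polar 1 i
  | at_Delta => radial at_dDelta i
  | at_dDelta => radial 2 i
  | at_D => polar at_dD i
  | at_dD => polar (- (2)) i
  | at_zinv =>
      vec4 0 (- (at_zinv * at_zinv)) (- (at_ia * (at_zinv * at_zinv))) 0 i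
  | at_winv =>
      vec4 0 (- (at_winv * at_winv)) (at_ia * (at_winv * at_winv)) 0 i
  | at_Deltainv => radial (- (at_dDelta * (at_Deltainv * at_Deltainv))) i
  | at_Dinv => polar (- (at_dD * (at_Dinv * at_Dinv))) i
  | at_weight =>
      radial (at_half * at_k * (at_dDelta * at_Deltainv * at_weight)) i
  | at_Phi l => at_Phi (i :: l)
  | at_a | at_ia | at_i | at_k | at_half => 0
  end%X.

Definition kerr_z : kexpr := (at_r + at_ia * at_q)%X.
Definition kerr_w : kexpr := (at_r - at_ia * at_q)%X.
Definition r2_plus_a2 : kexpr := (at_r * at_r + at_a * at_a)%X.
Definition a_sin2 : kexpr := (at_a * (1 - at_q * at_q))%X.

Definition coframe_A : 'I_4 -> kexpr := vec4 1 0 0 (- a_sin2)%X.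
Definition coframe_B : 'I_4 -> kexpr := vec4 at_a 0 0 (- r2_plus_a2)%X.
Definition frame_X : 'I_4 -> kexpr := vec4 r2_plus_a2 0 0 at_a.
Definition frame_Y : 'I_4 -> kexpr := vec4 a_sin2 0 0 1.
Definition frame_r : 'I_4 -> kexpr := radial 1.
Definition frame_q : 'I_4 -> kexpr := polar 1.

Definition kerr_metric (m n : 'I_4) : kexpr :=
  (at_zinv * at_zinv * at_zinv * at_winv *
     (at_D * (coframe_B m * coframe_B n)
      - at_Delta * (coframe_A m * coframe_A n))
   + kerr_w * at_zinv * (at_Deltainv * (frame_r m * frame_r n)
                         + at_Dinv * (frame_q m * frame_q n)))%X.

Definition kerr_inv_metric (m n : 'I_4) : kexpr :=
  (kerr_z * at_winv *
     (at_Delta * (frame_r m * frame_r n) + at_D * (frame_q m * frame_q n)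
      + (at_Dinv * (frame_Y m * frame_Y n)
         - at_Deltainv * (frame_X m * frame_X n))))%X.

Definition kerr_form (m : 'I_4) : kexpr :=
  (at_i * at_Delta * at_zinv * at_winv
     * (at_half * at_dDelta * at_Deltainv - 2 * at_zinv) * coframe_A m
   - at_D * at_zinv * at_winv
     * (at_half * at_dD * at_Dinv - 2 * at_ia * at_zinv) * coframe_B m)%X.

Definition spin_form (m : 'I_4) : kexpr := (at_i * at_k * kerr_form m)%X.

Definition weighted_Phi : kexpr := (at_weight * kerr_z * at_Phi [::])%X.

Local Notation kerr_christoffel :=
  (christoffel kerr_d at_half kerr_metric kerr_inv_metric).
Local Notation kerr_ricci := (ricci kerr_d at_half kerr_metric kerr_inv_metric).
Local Notation kerr_scalar_curvature :=
  (scalar_curvature kerr_d at_half kerr_metric kerr_inv_metric).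
Local Notation kerr_laplacian :=
  (twisted_laplacian kerr_d at_half kerr_metric kerr_inv_metric).
Local Notation along := (twisted_along kerr_d).
Local Notation derive_Phi X := (derive_along kerr_d X (at_Phi [::])).
Local Notation derive2_Phi X := (derive_along kerr_d X (derive_Phi X)).

Definition carter_val (F : fieldType) (r q C dC D dD a i k W : F)
    (Phi : seq 'I_4 -> F) (b : kerr_atom) : F :=
  match b with
  | at_r => r
  | at_q => q
  | at_Delta => C
  | at_dDelta => dC
  | at_D => D
  | at_dD => dD
  | at_zinv => (r + i * a * q)^-1
  | at_winv => (r - i * a * q)^-1
  | at_Deltainv => C^-1
  | at_Dinv => D^-1
  | at_weight => W
  | at_a => a
  | at_ia => i * a
  | at_i => i
  | at_k => k
  | at_half => 2^-1
  | at_Phi l => Phi l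
  end.

Section CarterIdentities.
Variables (F : numFieldType) (r q C dC D dD a i k W : F).
Variable Phi : seq 'I_4 -> F.
Local Notation z := (r + i * a * q).
Local Notation w := (r - i * a * q).
Hypotheses (i_sqr : i ^+ 2 = -1) (z_neq0 : z != 0) (w_neq0 : w != 0).
Hypotheses (C_neq0 : C != 0) (D_neq0 : D != 0).
Local Notation ev := (eval_expr (carter_val r q C dC D dD a i k W Phi)).

Lemma kerr_metricV m n :
  \sum_(c < 4) ev (kerr_metric m c) * ev (kerr_inv_metric c n) = (m == n)%:R.
Proof.
rewrite sum_ord4; elim/ord4_ind: m; elim/ord4_ind: n => /=.
all: by field: i_sqr; rewrite ?z_neq0 ?w_neq0 ?C_neq0 ?D_neq0.
Qed.

Lemma kerr_scalar_curvatureE : ev kerr_scalar_curvature =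
  6 / w * (dC + i * a * dD) - 12 / (z * w) * (C + (i * a) ^+ 2 * D).
Proof.
vm_compute (scalar_curvature _ _ _ _); cbn [eval_expr carter_val].
by field: i_sqr; rewrite z_neq0 w_neq0 C_neq0 D_neq0.
Qed.

(* This is - sqrt|g|^-1 d_m (sqrt|g| g^mc), with sqrt|g| = w / z^3. *)
Lemma contracted_christoffel c :
  \sum_(m < 4) \sum_(n < 4)
    ev (kerr_inv_metric m n) * ev (kerr_christoffel c n m) =
  nth 0 [:: 0; - (z / w * (dC - 2 * C / z));
               - (z / w * (dD - 2 * (i * a) * D / z)); 0] c.
Proof.
transitivity (ev (sum_expr (fun m => sum_expr (fun n =>
    kerr_inv_metric m n * kerr_christoffel c n m)%X))).
  rewrite eval_sum; apply: eq_bigr => m _; rewrite eval_sum.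
  by apply: eq_bigr => n _; rewrite eval_mul.
elim/ord4_ind: c; rewrite [nth _ _ _]/=.
all: vm_compute (sum_expr _); cbn [eval_expr carter_val].
all: by field: i_sqr; rewrite ?z_neq0 ?w_neq0 ?C_neq0 ?D_neq0.
Qed.

Lemma frame_constant_along_itself m :
  [/\ ev (derive_along kerr_d frame_r (frame_r m)) = 0,
      ev (derive_along kerr_d frame_q (frame_q m)) = 0,
      ev (derive_along kerr_d frame_X (frame_X m)) = 0 &
      ev (derive_along kerr_d frame_Y (frame_Y m)) = 0].
Proof. by elim/ord4_ind: m. Qed.

Lemma kerr_laplacianE (theta : 'I_4 -> kexpr) e :
  ev (kerr_laplacian theta e) = z / w *
   ((C * ev (along theta frame_r (along theta frame_r e))
     + (dC - 2 * C / z) * ev (along theta frame_r e))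
    + (D * ev (along theta frame_q (along theta frame_q e))
       + (dD - 2 * (i * a) * D / z) * ev (along theta frame_q e))
    + ev (along theta frame_Y (along theta frame_Y e)) / D
    - ev (along theta frame_X (along theta frame_X e)) / C).
Proof.
rewrite eval_twisted_laplacian.
under [X in _ - X]eq_bigr do rewrite contracted_christoffel.
rewrite !eval_twisted_along_sqr => [|m|m|m|m];
  do ?by case: (frame_constant_along_itself m).
rewrite !eval_twisted_along !sum_ord4.
do !move: (ev (twisted_d _ _ _ _)) => ?.
by rewrite /=; ring.
Qed.

Lemma radial_part_weighted :
  C * ev (along spin_form frame_r (along spin_form frame_r weighted_Phi))
  + (dC - 2 * C / z) * ev (along spin_form frame_r weighted_Phi) =
  W * z * (C * Phi [:: i1; i1] + (k + 1) * dC * Phi [:: i1]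
    + (k + (k * dC) ^+ 2 / (4 * C) + dC / z - 2 * C / z ^+ 2) * Phi [::]).
Proof.
vm_compute (along _ _ (along _ _ _)); vm_compute (along _ _ _).
by cbn [eval_expr carter_val]; field; rewrite z_neq0 C_neq0.
Qed.

Lemma polar_part_weighted :
  D * ev (along spin_form frame_q (along spin_form frame_q weighted_Phi))
  + (dD - 2 * (i * a) * D / z) * ev (along spin_form frame_q weighted_Phi) =
  W * z * (D * Phi [:: i2; i2] + dD * Phi [:: i2]
    + (i * a * dD / z - 2 * (i * a) ^+ 2 * D / z ^+ 2) * Phi [::]).
Proof.
vm_compute (along _ _ (along _ _ _)); vm_compute (along _ _ _).
by cbn [eval_expr carter_val]; field; rewrite z_neq0.
Qed.

Lemma along_X_sqr_weighted :
  ev (along spin_form frame_X (along spin_form frame_X weighted_Phi)) =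
  W * z * (ev (derive2_Phi frame_X)
    - k * (dC - 4 * C / z) * ev (derive_Phi frame_X)
    + (k * (dC / 2 - 2 * C / z)) ^+ 2 * Phi [::]).
Proof.
vm_compute (along _ _ _); vm_compute (derive2_Phi _); vm_compute (derive_Phi _).
cbn [eval_expr carter_val].
by field: i_sqr; rewrite z_neq0 w_neq0 C_neq0 D_neq0.
Qed.

Lemma along_Y_sqr_weighted :
  ev (along spin_form frame_Y (along spin_form frame_Y weighted_Phi)) =
  W * z * (ev (derive2_Phi frame_Y)
    + i * k * (dD - 4 * (i * a) * D / z) * ev (derive_Phi frame_Y)
    - (k * (dD / 2 - 2 * (i * a) * D / z)) ^+ 2 * Phi [::]).
Proof.
vm_compute (along _ _ _); vm_compute (derive2_Phi _); vm_compute (derive_Phi _).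
cbn [eval_expr carter_val].
by field: i_sqr; rewrite z_neq0 w_neq0 C_neq0 D_neq0.
Qed.

Definition frame_teukolsky : F :=
  ev (derive2_Phi frame_X) / C - ev (derive2_Phi frame_Y) / D
  - (C * Phi [:: i1; i1] + (k + 1) * dC * Phi [:: i1])
  - (D * Phi [:: i2; i2] + dD * Phi [:: i2])
  - k * (dC / C * ev (derive_Phi frame_X)
         + i * (dD / D) * ev (derive_Phi frame_Y) - 4 * w * Phi [:: i0])
  + (k ^+ 2 * dD ^+ 2 / (4 * D) - k) * Phi [::].

Lemma weighted_laplacian_teukolsky : W != 0 ->
  z^-1 / w^-1 * (z^-1 / W)
    * (- ev (kerr_laplacian spin_form weighted_Phi)
       + (1 + 2 * k ^+ 2) / 6 * ev kerr_scalar_curvature * ev weighted_Phi) =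
  frame_teukolsky.
Proof.
move=> W_neq0; rewrite kerr_laplacianE kerr_scalar_curvatureE.
rewrite radial_part_weighted polar_part_weighted.
rewrite along_X_sqr_weighted along_Y_sqr_weighted /frame_teukolsky.
have -> : Phi [:: i0] =
    (ev (derive_Phi frame_X) - a * ev (derive_Phi frame_Y)) / (z * w).
  by rewrite /=; field: i_sqr; rewrite z_neq0 w_neq0.
rewrite [ev weighted_Phi]/=.
by field: i_sqr; rewrite z_neq0 w_neq0 C_neq0 D_neq0 W_neq0.
Qed.

Definition coordinate_teukolsky (M : F) : F :=
  ((r ^+ 2 + a ^+ 2) ^+ 2 / C - a ^+ 2 * D) * Phi [:: i0; i0]
  + 4 * M * a * r / C * Phi [:: i0; i3]
  + (a ^+ 2 / C - 1 / D) * Phi [:: i3; i3]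
  - (C * Phi [:: i1; i1] + (k + 1) * dC * Phi [:: i1])
  - (D * Phi [:: i2; i2] + dD * Phi [:: i2])
  - 2 * k * (M * (r ^+ 2 - a ^+ 2) / C - r + i * (a * q)) * Phi [:: i0]
  - 2 * k * (a * (r - M) / C - i * (q / D)) * Phi [:: i3]
  + (k ^+ 2 * (q ^+ 2 / D) - k) * Phi [::].

Lemma coordinate_teukolsky_frame (M : F) :
  C = r ^+ 2 - 2 * M * r + a ^+ 2 -> dC = 2 * r - 2 * M ->
  D = 1 - q ^+ 2 -> dD = - (2 * q) ->
  Phi [:: i0; i3] = Phi [:: i3; i0] ->
  coordinate_teukolsky M = frame_teukolsky.
Proof.
move=> CE dCE DE dDE PhiC; rewrite /coordinate_teukolsky /frame_teukolsky.
rewrite /= PhiC; move: C_neq0 D_neq0; rewrite CE DE dCE dDE => C0 D0.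
by field: i_sqr; rewrite C0 D0.
Qed.

End CarterIdentities.

(** * The Kerr exterior as a model of the expressions *)

Section KerrFunctions.
Context {R : realType}.
Local Notation pt := ('rV[R]_4).
Local Notation C := (R[i]).
Variables (M a : R).
Implicit Types (i j : 'I_4) (x y : pt) (r q : R).

Lemma kcoordD x s i j :
  kcoord (x + s *: ei i) j = kcoord x j + s * (i == j)%:R.
Proof. by rewrite /kcoord /ei !mxE eqxx eq_sym. Qed.

Lemma is_pd_coord (h : R -> R) (d : R) i j x :
  is_derive (kcoord x j) 1 h d ->
  is_pd i (fun y => (h (kcoord y j))%:C) x (if i == j then d%:C else 0).
Proof.
rewrite /is_pd; under eq_fun do rewrite kcoordD.
case: (i == j) => dh; last first.
  by under eq_fun do rewrite mulr0 addr0; exact: is_cderive_cst.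
under eq_fun do rewrite mulr1 addrC.
apply: is_cderive_real; rewrite -[d]mulr1.
apply: (is_derive1_comp (f := h) _ (is_derive_shift 0 1 (kcoord x j))).
by rewrite /shift /= add0r.
Qed.

Lemma is_derive_Delta r : is_derive r 1 (Delta M a) (2 * r - 2 * M).
Proof.
rewrite (_ : Delta M a = id ^+ 2 - (2 * M) \*: (id : R -> R) + cst (a ^+ 2)).
  by apply: is_derive_eq; rewrite /GRing.scale /=; ring.
by apply/funext => s.
Qed.

Lemma is_derive_Dq q : is_derive q 1 (@Dq R) (- (2 * q)).
Proof.
rewrite (_ : @Dq R = cst 1 - id ^+ 2); last by apply/funext => s.
by apply: is_derive_eq; rewrite /GRing.scale /=; ring.
Qed.

Lemma is_derive_affine (b c s : R) : is_derive s 1 (fun t => b * t + c) b.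
Proof.
rewrite (_ : (fun t => _) = b \*: (id : R -> R) + cst c); last exact/funext.
by apply: is_derive_eq; rewrite /GRing.scale /=; ring.
Qed.

Lemma powR_succ (b p : R) : 0 < b -> b `^ (p + 1) = b `^ p * b.
Proof.
by move=> b0; rewrite powRD ?powRr1 ?(ltW b0) // (gt_eqF b0) implybT.
Qed.

Lemma is_derive_Delta_powR (p r : R) : 0 < Delta M a r ->
  is_derive r 1 (fun r => Delta M a r `^ p)
    (p * ((2 * r - 2 * M) / Delta M a r * Delta M a r `^ p)).
Proof.
move=> Delta_gt0; apply: is_derive_eq.
  exact: is_derive1_comp (is_derive1_powR p Delta_gt0) (is_derive_Delta r).
by rewrite -{4}(subrK 1 p) powR_succ //; field; rewrite gt_eqF.
Qed.

Lemma open_regionU : open (regionU M a).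
Proof.
have continuous_coord j : continuous (fun x : pt => kcoord x j).
  by move=> x; exact: coord_continuous.
have continuous_sqr j : continuous (fun x : pt => kcoord x j ^+ 2).
  move=> x; apply: (continuous_comp (f := fun x : pt => kcoord x j)
    (g := fun t => t ^+ 2)); [exact: continuous_coord|exact: exprn_continuous].
have continuous_Delta : continuous (fun x : pt => Delta M a (kcoord x i1)).
  move=> x; apply: (continuous_comp (f := fun x : pt => kcoord x i1)
    (g := Delta M a)); first exact: continuous_coord.
  apply/differentiable_continuous/derivable1_diffP.
  by case: (is_derive_Delta (kcoord x i1)).
have continuous_rho2 :
    continuous (fun x : pt => rho2 a (kcoord x i1) (kcoord x i2)).
  move=> x; have continuous_a2 : {for x, continuous (cst (a ^+ 2) : pt -> R)}.
    exact: cst_continuous.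
  exact: continuousD (continuous_sqr i1 x)
    (continuousM continuous_a2 (continuous_sqr i2 x)).
have open_preim (f : pt -> R) (B : set R) :
    continuous f -> open B -> open (f @^-1` B)%classic.
  by move=> continuous_f; apply: open_comp => x _; exact: continuous_f.
have -> : regionU M a = ([set x | 0 < Delta M a (kcoord x i1)]
    `&` ([set x | -1 < kcoord x i2] `&` [set x | kcoord x i2 < 1]
    `&` [set x | rho2 a (kcoord x i1) (kcoord x i2) != 0]))%classic.
  apply/seteqP; split=> x; first by move=> -[? [/andP[? ?] ?]].
  by move=> -[? [[? ?] ?]]; split=> //; split=> //; apply/andP.
apply: openI; [|apply: openI; [apply: openI|]].
- exact: open_preim continuous_Delta (@open_gt _ 0).
- exact: open_preim (continuous_coord i2) (@open_gt _ (-1)).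
- exact: open_preim (continuous_coord i2) (@open_lt _ 1).
- exact: open_preim continuous_rho2 (@open_neq _ 0).
Qed.

Lemma lampE x :
  lamp a x = ((kcoord x i1)%:C + 'i * a%:C * (kcoord x i2)%:C)^-1.
Proof. by rewrite /lamp; congr (_^-1); simpc. Qed.

Lemma lammE x :
  lamm a x = ((kcoord x i1)%:C - 'i * a%:C * (kcoord x i2)%:C)^-1.
Proof. by rewrite /lamm; congr (_^-1); simpc. Qed.

Lemma rho2C r q :
  (rho2 a r q)%:C = (r%:C + 'i * a%:C * q%:C) * (r%:C - 'i * a%:C * q%:C).
Proof. by rewrite /rho2; simpc; congr Complex; ring. Qed.

Lemma regionU_neq0 x : regionU M a x ->
  [/\ (kcoord x i1)%:C + 'i * a%:C * (kcoord x i2)%:C != 0,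
      (kcoord x i1)%:C - 'i * a%:C * (kcoord x i2)%:C != 0,
      (Delta M a (kcoord x i1))%:C != 0 & (Dq (kcoord x i2))%:C != 0].
Proof.
move=> -[/= Delta_gt0 [/andP[q_gt q_lt] rho2_neq0]].
have : (rho2 a (kcoord x i1) (kcoord x i2))%:C != 0 by rewrite fmorph_eq0.
rewrite rho2C mulf_eq0 negb_or => /andP[-> ->].
rewrite !fmorph_eq0 (gt_eqF Delta_gt0); split=> //.
rewrite (_ : Dq _ = (1 - kcoord x i2) * (1 + kcoord x i2)); last first.
  by rewrite /Dq; ring.
by rewrite mulf_neq0 // gt_eqF // ?subr_gt0 // -ltrBlDl sub0r.
Qed.

Variables (k : R) (Phi : pt -> C).

Definition kerr_val x : kerr_atom -> C :=
  carter_val (kcoord x i1)%:C (kcoord x i2)%:C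
    (Delta M a (kcoord x i1))%:C (2 * kcoord x i1 - 2 * M)%:C
    (Dq (kcoord x i2))%:C (- (2 * kcoord x i2))%:C
    a%:C 'i%R k%:C (Delta M a (kcoord x i1) `^ (k / 2))%:C
    (fun js => iterpd js Phi x).

Lemma is_pd_kerr_z x i (c : C) :
  is_pd i (fun y => (kcoord y i1)%:C + c * (kcoord y i2)%:C) x
    ((if i == i1 then 1 else 0) + c * (if i == i2 then 1 else 0)).
Proof.
have dr := is_pd_coord i (is_derive_id (kcoord x i1) (1 : R)).
have dq := is_pd_coord i (is_derive_id (kcoord x i2) (1 : R)).
apply: is_cderive_eq (is_cderiveD dr (is_cderiveM (is_cderive_cst 0 c) dq)) _.
by rewrite mul0r add0r.
Qed.

Hypothesis smooth_Phi : smooth_on (regionU M a) Phi.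

Lemma is_pd_kerr_atom x i (b : kerr_atom) : regionU M a x ->
  is_pd i (fun y => kerr_val y b) x (eval_expr (kerr_val x) (kerr_d i b)).
Proof.
move=> Ux; have [z0 w0 C0 D0] := regionU_neq0 Ux; have [Delta_gt0 _] := Ux.
have dDelta := is_pd_coord i (is_derive_Delta (kcoord x i1)).
have dDq := is_pd_coord i (is_derive_Dq (kcoord x i2)).
(* Goals 12 to 16 are the constants, goal 17 is [at_Phi]. *)
case: b => [||||||||||||||||js].
17: exact: is_pd_iterpd smooth_Phi Ux.
12-16: apply: is_cderive_eq (is_cderive_cst _ _) _.
12-16: by elim/ord4_ind: i {dDelta dDq}.
- apply: is_cderive_eq (is_pd_coord i (is_derive_id _ _)) _.
  by elim/ord4_ind: i {dDelta dDq}.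
- apply: is_cderive_eq (is_pd_coord i (is_derive_id _ _)) _.
  by elim/ord4_ind: i {dDelta dDq}.
- by apply: is_cderive_eq dDelta _; elim/ord4_ind: i {dDq}.
- apply: is_cderive_eq (is_pd_coord i (is_derive_affine 2 (- (2 * M)) _)) _.
  by elim/ord4_ind: i {dDelta dDq} => //=; simpc.
- by apply: is_cderive_eq dDq _; elim/ord4_ind: i {dDelta}.
- have ddDq : is_derive (kcoord x i2) 1 (fun q => - (2 * q)) (-2).
    have := is_derive_affine (-2) 0 (kcoord x i2).
    by under eq_fun do rewrite addr0 mulNr.
  apply: is_cderive_eq (is_pd_coord i ddDq) _.
  by elim/ord4_ind: i {dDelta dDq} => //=; simpc.
- apply: is_cderive_eq (is_pdV z0 (is_pd_kerr_z x i ('i * a%:C))) _.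
  by elim/ord4_ind: i {dDelta dDq} => /=; field.
- have := is_pd_kerr_z x i (- ('i * a%:C)); under eq_fun do rewrite mulNr.
  move/(is_pdV w0)/is_cderive_eq; apply.
  by elim/ord4_ind: i {dDelta dDq} => /=; field.
- apply: is_cderive_eq (is_pdV C0 dDelta) _.
  by elim/ord4_ind: i {dDelta dDq} => /=; field.
- apply: is_cderive_eq (is_pdV D0 dDq) _.
  by elim/ord4_ind: i {dDelta dDq} => /=; field.
- have dW := is_pd_coord i (is_derive_Delta_powR (k / 2) Delta_gt0).
  apply: is_cderive_eq dW _.
  elim/ord4_ind: i {dDelta dDq} => //=.
  by rewrite !(rmorphM, fmorphV, rmorph_nat) /=; ring.
Qed.

End KerrFunctions.

Section KerrOperator.
Context {R : realType}.
Local Notation pt := ('rV[R]_4).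
Local Notation C := (R[i]).
Variables (M a k : R) (Phi : pt -> C).
Local Notation U := (regionU M a).
Local Notation ev x := (eval_expr (kerr_val M a k Phi x)).
Implicit Types (x y : pt) (b c d m n : 'I_4).

Lemma formAE x m : (Defs.formA a x m)%:C = ev x (coframe_A m).
Proof.
elim/ord4_ind: m => //=; rewrite /Defs.formA /= /Dq.
by rewrite !(rmorphM, rmorphN, rmorphB, rmorph1, rmorphXn); ring.
Qed.

Lemma formBE x m : (Defs.formB a x m)%:C = ev x (coframe_B m).
Proof.
elim/ord4_ind: m => //=; rewrite /Defs.formB /=.
by rewrite !(rmorphN, rmorphD, rmorphXn); ring.
Qed.

Lemma gmetE x m n :
  U x -> gmet M a x m n = ev x (kerr_metric m n).
Proof.
move=> /regionU_neq0[z0 w0 C0 D0].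
have gKerrC (c p d A A' B B' e e' : R) :
    (- (c / p) * A * A' + p / c * e + p / d * e' + d / p * B * B')%:C =
    - (c%:C / p%:C) * A%:C * A'%:C + p%:C / c%:C * e%:C + p%:C / d%:C * e'%:C
    + d%:C / p%:C * B%:C * B'%:C.
  by rewrite !(rmorphD, rmorphN, rmorphM, fmorphV).
rewrite mxE /gKerr gKerrC !formAE !formBE rho2C lampE {gKerrC}.
elim/ord4_ind: m; elim/ord4_ind: n => /=; rewrite /kd /=.
all: by field; rewrite ?z0 ?w0 ?C0 ?D0.
Qed.

Lemma ginvE x m n :
  U x -> ginv M a x m n = ev x (kerr_inv_metric m n).
Proof.
move=> Ux; have [z0 w0 C0 D0] := regionU_neq0 Ux.
pose G := \matrix_(m, n) ev x (kerr_inv_metric m n).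
have gG : gmet M a x *m G = 1%:M.
  apply/matrixP => c d; rewrite !mxE.
  rewrite -[RHS](_ : \sum_(e < 4) ev x (kerr_metric c e)
    * ev x (kerr_inv_metric e d) = _).
    by apply: eq_bigr => e _; rewrite gmetE // mxE.
  by apply: kerr_metricV => //; exact: sqrCi.
have [g_unit _] := mulmx1_unit gG.
suff -> : ginv M a x = G by rewrite mxE.
by rewrite /ginv -[LHS]mulmx1 -gG mulKmx.
Qed.

Lemma aformE x m : U x -> aform M a x m = ev x (kerr_form m).
Proof.
move=> /regionU_neq0[z0 w0 C0 D0].
have quotientC (c p : R) : (c / p)%:C = c%:C / p%:C by rewrite rmorphM fmorphV.
have half_quotientC (c p : R) : (c / (2 * p))%:C = 2^-1 * c%:C / p%:C.
  by rewrite invfM !rmorphM !fmorphV rmorph_nat mulrCA mulrA.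
rewrite /aform !half_quotientC !quotientC rho2C formAE formBE lampE.
rewrite !eval_opE /=.
move: (eval_expr _ (coframe_A m)) (eval_expr _ (coframe_B m)) => A B.
by field; rewrite z0 w0 C0 D0.
Qed.

Hypothesis smooth_Phi : smooth_on U Phi.

Lemma pd_kerr_expr (f : pt -> C) e m x : U x ->
  (forall y, U y -> f y = ev y e) ->
  pd m f x = ev x (derive_expr (kerr_d m) e).
Proof.
apply: pd_eval; first exact: open_regionU.
by move=> y n b; exact: is_pd_kerr_atom.
Qed.

Lemma ChrE x c m n :
  U x -> Chr M a x c m n = ev x (kerr_christoffel c m n).
Proof.
move=> Ux; rewrite /Chr eval_mul eval_sum; congr (_ * _).
apply: eq_bigr => d _; rewrite eval_mul ginvE //; congr (_ * _).
rewrite !(eval_add, eval_opp).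
by rewrite !(pd_kerr_expr _ Ux (fun y => gmetE _ _)).
Qed.

Lemma RicE x m n : U x -> Ric M a x m n = ev x (kerr_ricci m n).
Proof.
move=> Ux; rewrite /Ric eval_sum; apply: eq_bigr => c _.
rewrite eval_add eval_sum eval_add eval_opp; congr (_ - _ + _).
- by apply: pd_kerr_expr => // y Uy; exact: ChrE.
- by apply: pd_kerr_expr => // y Uy; exact: ChrE.
- apply: eq_bigr => d _; rewrite eval_add eval_opp !ChrE //.
  by congr (_ - _); exact: esym (eval_mul _ _ _).
Qed.

Lemma scalE x : U x -> scal M a x = ev x kerr_scalar_curvature.
Proof.
move=> Ux; rewrite eval_sum; apply: eq_bigr => m _.
rewrite eval_sum; apply: eq_bigr => n _; rewrite ginvE // RicE //.
exact: esym (eval_mul _ _ _).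
Qed.

Local Notation Psi := (fun x =>
  (Delta M a (kcoord x i1) `^ (k / 2))%:C / lamp a x * Phi x).

Lemma weightedE x : Psi x = ev x weighted_Phi.
Proof. by rewrite /= lampE invrK. Qed.

Lemma vfieldE x m : U x ->
  vfield M a k Psi x m =
  ev x (twisted_d kerr_d spin_form weighted_Phi m).
Proof.
move=> Ux; rewrite /vfield weightedE aformE //.
rewrite (pd_kerr_expr m Ux (fun y _ => weightedE y)).
by rewrite [RHS]eval_add; congr (_ + _); rewrite !eval_mul.
Qed.

Lemma OkE x : U x -> Ok M a k Psi x =
  - ev x (kerr_laplacian spin_form weighted_Phi)
  + ((1 + 2 * k ^+ 2) / 6)%:C * ev x kerr_scalar_curvature
    * ev x weighted_Phi.
Proof.
move=> Ux; rewrite /Ok (scalE Ux) weightedE.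
apply: (congr1 (fun l => - l + _)).
rewrite eval_sum; apply: eq_bigr => m _; rewrite eval_sum.
apply: eq_bigr => n _; rewrite ginvE // eval_mul; congr (_ * _).
rewrite eval_add eval_add eval_opp eval_sum; congr (_ - _ + _).
- by apply: pd_kerr_expr => // y Uy; exact: vfieldE.
- apply: eq_bigr => c _; rewrite ChrE // vfieldE //.
  exact: esym (eval_mul _ _ _).
- by rewrite aformE // vfieldE // !eval_mul.
Qed.

Definition teukolsky_at x : C :=
  coordinate_teukolsky (kcoord x i1)%:C (kcoord x i2)%:C
    (Delta M a (kcoord x i1))%:C (2 * kcoord x i1 - 2 * M)%:C
    (Dq (kcoord x i2))%:C (- (2 * kcoord x i2))%:C
    a%:C 'i%R k%:C (fun js => iterpd js Phi x) M%:C.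

Lemma conjugated_Ok x : U x ->
  lamp a x / lamm a x
  * (lamp a x / (Delta M a (kcoord x i1) `^ (k / 2))%:C) * Ok M a k Psi x =
  teukolsky_at x.
Proof.
move=> Ux; have [z0 w0 C0 D0] := regionU_neq0 Ux; have [Delta_gt0 _] := Ux.
rewrite (OkE Ux) lampE lammE.
have couplingC : ((1 + 2 * k ^+ 2) / 6)%:C = (1 + 2 * k%:C ^+ 2) / 6 :> C.
  by rewrite rmorphM fmorphV rmorphD rmorphM rmorphXn !rmorph_nat.
have W0 : (Delta M a (kcoord x i1) `^ (k / 2))%:C != 0.
  by rewrite fmorph_eq0 gt_eqF // powR_gt0.
rewrite couplingC.
rewrite (weighted_laplacian_teukolsky _ _ _ _ (sqrCi _) z0 w0 C0 D0 W0).
symmetry; apply: (coordinate_teukolsky_frame _ _ (sqrCi _) C0 D0).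
- by rewrite /Delta rmorphD rmorphB !rmorphXn !rmorphM rmorph_nat.
- by rewrite rmorphB !rmorphM !rmorph_nat.
- by rewrite /Dq rmorphB rmorphXn.
- by rewrite rmorphN rmorphM rmorph_nat.
- exact: (pdC i0 i3 (@open_regionU _ M a) smooth_Phi Ux).
Qed.

End KerrOperator.

(** * The substitution q = cos theta *)

Section Teukolsky.
Context {R : realType}.
Local Notation pt := ('rV[R]_4).
Local Notation C := (R[i]).
Implicit Types (i j : 'I_4) (x y z : pt) (s : R) (f : pt -> C) (l : C).

Lemma kcoord_inj x y : (forall j, kcoord x j = kcoord y j) -> x = y.
Proof. by move=> xy; apply/matrixP => m j; rewrite ord1; exact: xy. Qed.

Lemma kcoord_mkpt (x0 x1 x2 x3 : R) j :
  kcoord (mkpt x0 x1 x2 x3) j = nth 0 [:: x0; x1; x2; x3] j.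
Proof. by rewrite /kcoord mxE. Qed.

Definition cos_pt y : pt :=
  mkpt (kcoord y i0) (kcoord y i1) (cos (kcoord y i2)) (kcoord y i3).

Lemma kcoord_cos_pt y j :
  kcoord (cos_pt y) j = if j == i2 then cos (kcoord y i2) else kcoord y j.
Proof. by rewrite kcoord_mkpt; elim/ord4_ind: j. Qed.

Lemma cos_pt_line y s i : i != i2 ->
  cos_pt (y + s *: ei i) = cos_pt y + s *: ei i.
Proof.
move=> /negbTE ni; apply: kcoord_inj => j.
rewrite kcoordD !kcoord_cos_pt !kcoordD ni mulr0 addr0.
by case: eqP => // ->; rewrite ni mulr0 addr0.
Qed.

Lemma cos_pt_polar_line y s : cos_pt (y + s *: ei i2) =
  cos_pt y + (cos (kcoord y i2 + s) - cos (kcoord y i2)) *: ei i2.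
Proof.
apply: kcoord_inj => j; rewrite kcoordD !kcoord_cos_pt !kcoordD eqxx mulr1.
rewrite [i2 == j]eq_sym; case: eqP => _; last by rewrite !mulr0.
by rewrite mulr1 [RHS]addrC subrK.
Qed.

Lemma pd_cos_pt i f y : i != i2 ->
  pd i (fun z => f (cos_pt z)) y = pd i f (cos_pt y).
Proof.
by move=> ni; rewrite /pd; under eq_fun do rewrite cos_pt_line //;
  under [X in Complex _ (X^`()%classic _)]eq_fun do rewrite cos_pt_line //.
Qed.

Lemma Dq_cos (th : R) : Dq (cos th) = sin th ^+ 2.
Proof. by rewrite /Dq -(cos2Dsin2 th) addrAC subrr add0r. Qed.

Lemma is_derive_cos_line (th : R) :
  is_derive (0 : R) 1 (fun s => cos (th + s) - cos th) (- sin th).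
Proof.
have dcos : is_derive (0 : R) 1 (@cos R \o shift th) (- sin th).
  rewrite -[- sin th]mulr1; apply: (is_derive1_comp _ (is_derive_shift 0 1 th)).
  by rewrite /shift /= add0r; exact: is_derive_cos.
have := is_deriveB dcos (is_derive_cst (cos th) (0 : R) 1); rewrite subr0.
by congr (is_derive _ _ _ _); apply/funext => s; rewrite [th + s]addrC.
Qed.

Lemma is_pd_cos_pt f y l : is_pd i2 f (cos_pt y) l ->
  is_pd i2 (fun z => f (cos_pt z)) y ((- sin (kcoord y i2))%:C * l).
Proof.
move=> df; rewrite /is_pd; under eq_fun do rewrite cos_pt_polar_line.
apply: (is_cderive_comp (f := fun s => f (cos_pt y + s *: ei i2)) _
  (is_derive_cos_line _)).
by rewrite addr0 subrr.
Qed.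

Variables (M a k : R) (Phi : pt -> C).
Hypothesis smooth_Phi : smooth_on (regionU M a) Phi.
Local Notation U := (regionU M a).

Lemma near_cos_pt y : U (cos_pt y) ->
  \forall s \near (0 : R), U (cos_pt (y + s *: ei i2)).
Proof.
move=> Uy; near=> s; rewrite cos_pt_polar_line; near: s.
have continuous_cos_line : {for 0, continuous
    (fun s => cos (kcoord y i2 + s) - cos (kcoord y i2))}.
  apply/differentiable_continuous/derivable1_diffP.
  by case: (is_derive_cos_line (kcoord y i2)).
apply: (continuous_cos_line [set t | U (cos_pt y + t *: ei i2)]%classic).
by rewrite addr0 subrr; apply: near_line => //; exact: open_regionU.
Unshelve. all: by end_near. Qed.

Lemma radial_term y : U (cos_pt y) ->
  (Delta M a (kcoord y i1) `^ (- k))%:C *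
  pd i1 (fun z => (Delta M a (kcoord z i1) `^ (k + 1))%:C
                  * pd i1 (fun z => Phi (cos_pt z)) z) y =
  (Delta M a (kcoord y i1))%:C * iterpd [:: i1; i1] Phi (cos_pt y)
  + (k%:C + 1) * (2 * kcoord y i1 - 2 * M)%:C * iterpd [:: i1] Phi (cos_pt y).
Proof.
move=> Uy; pose G x := (Delta M a (kcoord x i1) `^ (k + 1))%:C * pd i1 Phi x.
rewrite (_ : (fun z => _) = fun z => G (cos_pt z)); last first.
  by apply/funext => z; rewrite /G kcoord_cos_pt /= pd_cos_pt.
have [Delta_gt0 _] := Uy; rewrite pd_cos_pt //.
have dDelta_pow := is_pd_coord i1 (is_derive_Delta_powR (k + 1) Delta_gt0).
rewrite (is_pd_val (is_pdM dDelta_pow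
  (is_pd_iterpd i1 [:: i1] smooth_Phi Uy))).
move: Delta_gt0; rewrite kcoord_cos_pt /= => Delta_gt0.
have pow_gt0 := powR_gt0 k Delta_gt0; rewrite (powR_succ k Delta_gt0) powRN.
move: (Delta M a _) (Delta M a _ `^ k) Delta_gt0 pow_gt0 => D pow D_gt0 pow_gt0.
rewrite !(rmorphM, fmorphV, rmorphD) rmorph1 /=.
by field; rewrite !fmorph_eq0 !gt_eqF.
Qed.

Lemma polar_term y : U (cos_pt y) -> sin (kcoord y i2) != 0 ->
  (1 / sin (kcoord y i2))%:C *
  pd i2 (fun z => (sin (kcoord z i2))%:C
                  * pd i2 (fun z => Phi (cos_pt z)) z) y =
  (Dq (cos (kcoord y i2)))%:C * iterpd [:: i2; i2] Phi (cos_pt y)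
  + (- (2 * cos (kcoord y i2)))%:C * iterpd [:: i2] Phi (cos_pt y).
Proof.
move=> Uy sin_neq0.
have dDq := is_pd_coord i2 (is_derive_Dq (kcoord (cos_pt y) i2)).
have dDq_Phi := is_pd_cos_pt
  (is_pdN (is_pdM dDq (is_pd_iterpd i2 [:: i2] smooth_Phi Uy))).
rewrite (is_pd_val (near_eq_is_cderive _ dDq_Phi)).
  have sinC_neq0 : (sin (kcoord y i2))%:C != 0 by rewrite fmorph_eq0.
  by rewrite kcoord_cos_pt /= div1r fmorphV rmorphN /=; field.
near=> s.
have Uz : U (cos_pt (y + s *: ei i2)) by near: s; exact: near_cos_pt.
rewrite (is_pd_val (is_pd_cos_pt (is_pd_iterpd i2 [::] smooth_Phi Uz))).
rewrite kcoord_cos_pt /= mulrA -rmorphM mulrN rmorphN mulNr -expr2.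
by rewrite Dq_cos.
Unshelve. all: by end_near. Qed.

Lemma Teuk_cos_pt y : U (cos_pt y) -> sin (kcoord y i2) != 0 ->
  Teuk M a k (fun z => Phi (cos_pt z)) y = teukolsky_at M a k Phi (cos_pt y).
Proof.
move=> Uy sin_neq0.
have pdE i : i != i2 ->
    pd i (fun z => Phi (cos_pt z)) = fun z => pd i Phi (cos_pt z).
  by move=> ni; apply/funext => z; exact: pd_cos_pt.
rewrite /Teuk /teukolsky_at /coordinate_teukolsky !kcoord_cos_pt /=.
rewrite (radial_term Uy) (polar_term Uy sin_neq0) !pdE // !pd_cos_pt //.
rewrite Dq_cos.
move: (Delta M a _) => D; move: (kcoord y i1) (sin _) (cos _) => r S Q.
congr (_ * _ + _ * _ + _ * _ - _ - _ - _ * _ * _ - _ * _ * _ + _ * _).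
all: rewrite ?expr_div_n !(rmorphD, rmorphN, rmorphM, fmorphV, rmorphXn) /=.
all: by rewrite ?rmorph_nat ?rmorph1.
Qed.

End Teukolsky.

Lemma regionU_mkpt_cos (R : realType) (M a t r th ph : R) :
  0 < Delta M a r -> 0 < th < pi -> rho2 a r (cos th) != 0 ->
  regionU M a (mkpt t r (cos th) ph).
Proof.
move=> Delta_gt0 /sin_gt0_pi sin_gt0 rho_neq0.
rewrite /regionU /= !kcoord_mkpt /=; do 2!split=> //.
rewrite -ltr_norml -(@expr_lt1 _ 2) // real_normK ?num_real // -subr_gt0.
by rewrite -[_ - _]/(Dq _) Dq_cos exprn_gt0.
Qed.

Unset Implicit Arguments.

Theorem theoremA (R : realType) (M a k : R)
  (hk : exists n : int, k = n%:~R / 2)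
  (Phi : 'rV[R]_4 -> R[i]) (HPhi : smooth_on (regionU M a) Phi)
  (t r th ph : R)
  (hD : 0 < Delta M a r) (hth : 0 < th < pi)
  (hring : rho2 a r (cos th) != 0) :
  Teuk M a k
    (fun y => Phi (mkpt (kcoord y i0) (kcoord y i1) (cos (kcoord y i2)) (kcoord y i3)))
    (mkpt t r th ph)
  = (lamp a (mkpt t r (cos th) ph) / lamm a (mkpt t r (cos th) ph))
    * (lamp a (mkpt t r (cos th) ph) / ((Delta M a r) `^ (k / 2))%:C)
    * Ok M a k
        (fun x => ((Delta M a (kcoord x i1)) `^ (k / 2))%:C / lamp a x * Phi x)
        (mkpt t r (cos th) ph).
Proof.
set x := mkpt t r (cos th) ph; set y := mkpt t r th ph.
have cos_y : cos_pt y = x by rewrite /cos_pt !kcoord_mkpt.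
have Ux : regionU M a x by exact: regionU_mkpt_cos.
have Uy : regionU M a (cos_pt y) by rewrite cos_y.
have x_r : kcoord x i1 = r by rewrite kcoord_mkpt.
have sin_neq0 : sin (kcoord y i2) != 0.
  by rewrite kcoord_mkpt lt0r_neq0 // sin_gt0_pi.
rewrite [LHS](Teuk_cos_pt k HPhi Uy sin_neq0) cos_y -[in RHS]x_r.
exact: esym (conjugated_Ok k HPhi Ux).
Qed.
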